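(* Let $Ath:=\Diamond\Diamond p\to\square\Diamond p$, and let $\Lambda$ be either $\mathbf{K}+Ath$ or $\mathbf{K}+\square^n\bot+Ath$ for some $n\geq 1$. Then the product $\Lambda\times\mathbf{S5}$ has the product finite model property, and the semiproduct $\Lambda\rightthreetimes\mathbf{S5}$ has the semiproduct finite model property.
   Context: All propositional modal logics are normal. $\Lambda$ is in the language with the modality $\square$ (dual $\Diamond$), and $\mathbf{S5}$ is in the language with the modality $\blacksquare$. $L+A$ denotes the smallest normal modal logic containing $L$ and the formula $A$; $\mathbf{K}$ is the minimal normal modal logic; $\square^n$ is $\square$ iterated $n$ times. The product of Kripke frames $F_1=(U_1,R_1)$ and $F_2=(U_2,R_2)$ is $F_1\times F_2:=(U_1\times U_2,R_h,R_v)$ with $R_h(u,v)=R_1(u)\times\{v\}$ and $R_v(u,v)=\{u\}\times R_2(v)$, where $R(x)=\{y\mid xRy\}$. A semiproduct of $F_1$ and $F_2$ is a restriction of $F_1\times F_2$ to a nonempty subset $W\subseteq U_1\times U_2$ such that $R_h(W)\subseteq W$. The modality $\square$ is interpreted by $R_h$ and $\blacksquare$ by $R_v$. $\Lambda\times\mathbf{S5}$ (respectively $\Lambda\rightthreetimes\mathbf{S5}$) is the bimodal logic (set of valid formulas) of the class of all products (respectively semiproducts) of $\Lambda$-frames with $\mathbf{S5}$-frames (an $L$-frame is a Kripke frame validating $L$). $\Lambda\times\mathbf{S5}$ has the product finite model property if it is the logic of the class of all finite products of a $\Lambda$-frame with an $\mathbf{S5}$-frame. $\Lambda\rightthreetimes\mathbf{S5}$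 has the semiproduct finite model property if it is the logic of the class of all finite semiproducts of a $\Lambda$-frame with an $\mathbf{S5}$-frame. *)

(* Defs.v *)
From mathcomp Require Import all_boot.
From mathcomp Require Import boolp classical_sets functions cardinality.

Set Implicit Arguments.
Unset Strict Implicit.
Unset Printing Implicit Defensive.

Local Open Scope classical_set_scope.

(* Formulas over countably many propositional variables, with one box for each
   element of the index type [M]: [unit] for unimodal languages, [modality]
   below for the language of products. *)
Inductive formula (M : Type) : Type :=
| Var of nat
| Bot
| Imp of formula M & formula M
| Box of M & formula M.
Arguments Var {M}.
Arguments Bot {M}.

Definition Neg M (A : formula M) : formula M := Imp A Bot.
Definition Dia M (m : M) (A : formula M) : formula M := Neg (Box m (Neg A)).

Fixpoint subst M (s : nat -> formula M) (A : formula M) : formula M :=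
  match A with
  | Var i => s i
  | Bot => Bot
  | Imp A1 A2 => Imp (subst s A1) (subst s A2)
  | Box m A1 => Box m (subst s A1)
  end.

(* [v] assigns a truth value to every formula, but is consulted only on
   variables and on boxed formulas, which are the Boolean atoms. *)
Fixpoint bool_eval M (v : formula M -> bool) (A : formula M) : bool :=
  match A with
  | Bot => false
  | Imp A1 A2 => bool_eval v A1 ==> bool_eval v A2
  | _ => v A
  end.

Definition tautology M (A : formula M) : Prop := forall v, bool_eval v A.

Record normal_logic M (L : set (formula M)) : Prop := {
  normal_taut : forall A, tautology A -> L A;
  normal_K : forall m A B,
    L (Imp (Box m (Imp A B)) (Imp (Box m A) (Box m B)));
  normal_MP : forall A B, L (Imp A B) -> L A -> L B;
  normal_subst : forall s A, L A -> L (subst s A);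
  normal_nec : forall m A, L A -> L (Box m A)
}.

Definition logic_K M : set (formula M) := smallest (@normal_logic M) set0.

Definition logic_add M (L : set (formula M)) (A : formula M) :
  set (formula M) := smallest (@normal_logic M) (L `|` [set A]).

Record frame (M : Type) := Frame {
  carrier :> Type;
  acc : M -> carrier -> set carrier;  (* [acc m x] is the set R_m(x) *)
  carrier_nonempty : [set: carrier] !=set0
}.

Fixpoint sat M (F : frame M) (V : nat -> set F) (x : F) (A : formula M) :
  Prop :=
  match A with
  | Var i => V i x
  | Bot => False
  | Imp A1 A2 => sat V x A1 -> sat V x A2
  | Box m A1 => forall y, acc m x y -> sat V y A1
  end.

Definition valid M (F : frame M) (A : formula M) : Prop :=
  forall (V : nat -> set F) (x : F), sat V x A.

(* Classes of frames are plain predicates: forming [set (frame M)] would put the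
   universe of carriers strictly below that of [set]. *)
Definition frames_of M (L : set (formula M)) (F : frame M) : Prop :=
  forall A, L A -> valid F A.

Definition logic_of M (C : frame M -> Prop) : set (formula M) :=
  [set A | forall F, C F -> valid F A].

Definition finite_frame M (F : frame M) : Prop :=
  finite_set [set: carrier F].

(* [hor] is the white box, interpreted by R_h; [ver] is the black box,
   interpreted by R_v. *)
Inductive modality := hor | ver.

Section Products.
Variables F1 F2 : frame unit.

Definition prod_rel (m : modality) (w : F1 * F2) : set (F1 * F2) :=
  match m with
  | hor => acc tt w.1 `*` [set w.2]
  | ver => [set w.1] `*` acc tt w.2
  end.

Lemma prod_nonempty : [set: F1 * F2] !=set0.
Proof.
have [x _] := carrier_nonempty F1; have [y _] := carrier_nonempty F2.
by exists (x, y).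
Qed.

Definition product : frame modality := Frame prod_rel prod_nonempty.

Section Restriction.
Variables (W : set (F1 * F2)) (W0 : W !=set0).

Notation points := {w : (F1 * F2)%type | w \in W}.

Definition restr_rel (m : modality) (w : points) : set points :=
  [set w' | prod_rel m (val w) (val w')].

Lemma restr_nonempty : [set: points] !=set0.
Proof. by have [w Ww] := W0; exists (exist _ w (mem_set Ww)). Qed.

Definition restriction : frame modality := Frame restr_rel restr_nonempty.

End Restriction.

Definition is_semiproduct (F : frame modality) : Prop :=
  exists (W : set (F1 * F2)) (W0 : W !=set0),
    \bigcup_(w in W) prod_rel hor w `<=` W /\ F = restriction W0.

End Products.

Definition product_frames (L1 L2 : set (formula unit)) (F : frame modality) :
    Prop :=
  exists F1 F2, [/\ frames_of L1 F1, frames_of L2 F2 & F = product F1 F2].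

Definition semiproduct_frames (L1 L2 : set (formula unit))
    (F : frame modality) : Prop :=
  exists F1 F2, [/\ frames_of L1 F1, frames_of L2 F2 & is_semiproduct F1 F2 F].

Definition product_logic (L1 L2 : set (formula unit)) :
    set (formula modality) :=
  logic_of (product_frames L1 L2).

Definition semiproduct_logic (L1 L2 : set (formula unit)) :
    set (formula modality) :=
  logic_of (semiproduct_frames L1 L2).

Definition product_fmp (L1 L2 : set (formula unit)) : Prop :=
  product_logic L1 L2 =
  logic_of (fun F => product_frames L1 L2 F /\ finite_frame F).

Definition semiproduct_fmp (L1 L2 : set (formula unit)) : Prop :=
  semiproduct_logic L1 L2 =
  logic_of (fun F => semiproduct_frames L1 L2 F /\ finite_frame F).

Definition logic_S5 : set (formula unit) :=
  let p := Var 0 in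
  logic_add
    (logic_add
      (logic_add (@logic_K unit) (Imp (Box tt p) p))
      (Imp (Box tt p) (Box tt (Box tt p))))
    (Imp p (Box tt (Dia tt p))).

Definition Ath : formula unit :=
  let p := Var 0 in Imp (Dia tt (Dia tt p)) (Box tt (Dia tt p)).

Definition box_iter (n : nat) (A : formula unit) : formula unit :=
  iter n (Box tt) A.

(* Main.v *)
(** Validity of [Ath] means that all successors of a point have the same
   successors. Hence the points reached from a root [x0] form levels
   [L 0 = {x0}, L 1, L 2, ...], every point of [L i] seeing exactly [L (i+1)],
   and a refuted formula of horizontal modal depth [d] only concerns the levels
   up to [d].

   Colour each point of the (semi)product by the truth values of the relevant
   formulas (or by its absence), and let the profile of [y] record which colours
   occur in column [y] at each level. The finite frame has boundedly many copies
   of each realized profile as vertical points, and as horizontal points at level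
   [i] the rows [y' |-> colour (x, s y')] with [x] in [L i], where [s] preserves
   profiles and no colour of row [x] is lost. Equality of profiles takes care of
   the white box, and the copies leave enough room to choose [s] with one
   prescribed value. *)
Require Import Defs.
From mathcomp Require Import all_boot.
From mathcomp Require Import boolp classical_sets functions cardinality.

Set Implicit Arguments.
Unset Strict Implicit.
Unset Printing Implicit Defensive.

Local Open Scope classical_set_scope.

(** * Soundness and frame conditions *)

Definition taccess (F : frame unit) : F -> set F := @acc unit F tt.
Arguments taccess {F}.

Definition euclidean2 (F : frame unit) : Prop :=
  forall x y u z : F, taccess x y -> taccess x u -> taccess y z -> taccess u z.

(** Reduces membership in [frames_of], for logics given by [smallest], to validity of their
    axioms. *)
Lemma valid_normal M (F : frame M) : normal_logic (valid F).
Proof.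
split.
- move=> A tA V x; have := tA (fun B => `[< sat V x B >]).
  suff -> : bool_eval (fun B => `[< sat V x B >]) A = `[< sat V x A >].
    by move/asboolP.
  elim: A {tA} => //= [|A IHA B IHB]; first by apply/esym/asboolP.
  by rewrite IHA IHB asbool_imply.
- by move=> m A B V x /= h hA y Rxy; apply: h (hA y Rxy).
- by move=> A B hAB hA V x; apply: hAB (hA V x).
- move=> s A hA V x.
  suff E B y : sat V y (subst s B) <-> sat (fun i => [set z | sat V z (s i)]) y B.
    by apply/E/hA.
  elim: B y => //= [B IHB C IHC|m B IHB] y; first by rewrite IHB IHC.
  by split=> h z Ryz; apply/IHB/h.
- by move=> m A hA V x y _; apply: hA.
Qed.

Lemma frames_of_K M (F : frame M) : frames_of (@logic_K M) F.
Proof. by apply: smallest_sub => //; apply: valid_normal. Qed.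

Lemma frames_of_add M (L : set (formula M)) A (F : frame M) :
  frames_of (logic_add L A) F <-> frames_of L F /\ valid F A.
Proof.
split=> [h|[hL hA]].
  by split=> [B LB|]; apply: h; apply: sub_gen_smallest; [left|right].
by apply: smallest_sub => [|B [/hL|->]] //; apply: valid_normal.
Qed.

Lemma valid_Ath (F : frame unit) : valid F Ath <-> euclidean2 F.
Proof.
split=> [h x y u z Rxy Rxu Ryz|h V x /= nn y Rxy nV].
  apply: contrapT => nRuz.
  apply: (h (fun _ => [set z]) x) Rxu _ => /= [n|w Ruw wz].
    by apply: (n y Rxy) => nz; apply: nz Ryz _.
  by apply: nRuz; rewrite -wz.
apply: nn => u Rxu; apply=> z Ruz Vz; apply: nV Vz.
exact: h Rxu Rxy Ruz.
Qed.

Lemma frames_of_S5 (F : frame unit) :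
  frames_of logic_S5 F <->
  [/\ forall x : F, taccess x x,
      forall x y z : F, taccess x y -> taccess y z -> taccess x z &
      forall x y : F, taccess x y -> taccess y x].
Proof.
rewrite /logic_S5 !frames_of_add; split=> [[[[_ hT] h4] hB]|[hT h4 hB]].
  split=> [x|x y z Rxy Ryz|x y Rxy].
  (* Least valuations satisfying the premise: the successors of [x] for T and 4, [x] alone for B. *)
  - exact: (hT (fun _ => taccess x) x).
  - exact: (h4 (fun _ => taccess x) x (fun _ => id)) Ryz.
  - apply: contrapT => nRyx.
    apply: (hB (fun _ => [set x]) x erefl y Rxy) => z Ryz /= zx.
    by apply: nRyx; rewrite -zx.
split; [split; [split|]|] => [|V x h|V x h y Rxy z Ryz|V x h y Rxy].
- exact: frames_of_K.
- exact: h (hT x).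
- exact: h (h4 _ _ _ Rxy Ryz).
- by apply; [apply: hB Rxy|].
Qed.

(** * Levels *)

Fixpoint level (F : frame unit) (x : F) (n : nat) : set F :=
  if n is m.+1 then \bigcup_(y in level x m) taccess y else [set x].

Lemma level_add (F : frame unit) (x : F) m n z :
  level x (m + n) z -> exists2 y, level x m y & level y n z.
Proof.
elim: n z => [|n IHn] z; first by rewrite addn0; exists z.
by rewrite addnS => -[w /IHn[y xy yw] wz]; exists y => //; exists w.
Qed.

Lemma valid_box_iter_Bot (F : frame unit) n :
  valid F (box_iter n Bot) <-> forall x y : F, ~ level x n y.
Proof.
suff E B V (x : F) : sat V x (box_iter n B) <->
    forall y, level x n y -> sat V y B.
  split=> [h x y xy|h V x]; last by apply/E => y /h.
  by have /E := h (fun _ => set0) x; apply; apply: xy.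
elim: n B => [|n IHn] B; first by split=> [h y ->//|]; apply.
(* [iterSr] feeds the innermost box to [B], matching the last edge of a path in [level]. *)
rewrite /box_iter iterSr -/(box_iter _ _) IHn; split=> [h z [y xy yz]|h y xy z yz].
  exact: h xy z yz.
by apply: h; exists y.
Qed.

(** If two points of a level have predecessors [a] and [b], then by induction [a] sees all that [b]
    sees, so both points are successors of [a]. *)
Lemma level_succ (F : frame unit) (x0 x : F) i : euclidean2 F ->
  level x0 i x -> level x0 i.+1 = taccess x.
Proof.
move=> hF; suff E y y' : level x0 i y -> level x0 i y' ->
    taccess y `<=` taccess y'.
  move=> hx; apply/seteqP; split=> z; last by exists x.
  by case=> y hy; apply: E.
elim: i y y' => [|i IHi] y y'; first by move=> -> ->.
move=> [a ha ay] [b hb bY] z yz.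
exact: (hF a y y' z ay) (IHi _ _ hb ha _ bY) yz.
Qed.

(** * Satisfaction relative to a subset of a product *)

Section RelativizedSatisfaction.
Variables (F1 F2 : frame unit) (W : set (F1 * F2)) (V : nat -> set (F1 * F2)).

(** Relativizing on pairs avoids subset types and treats products as the case [W = setT]. *)
Fixpoint rsat (w : F1 * F2) (A : formula modality) : Prop :=
  match A with
  | Var i => V i w
  | Bot => False
  | Imp A1 A2 => rsat w A1 -> rsat w A2
  | Box m A1 => forall w', prod_rel m w w' -> W w' -> rsat w' A1
  end.

Fixpoint agree (w w' : F1 * F2) (A : formula modality) : Prop :=
  (rsat w A <-> rsat w' A) /\
  match A with
  | Imp A1 A2 => agree w w' A1 /\ agree w w' A2
  | Box _ A1 => agree w w' A1
  | _ => True
  end.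

Lemma agree_rsat w w' A : agree w w' A -> (rsat w A <-> rsat w' A).
Proof. by case: A => [i||B C|m B] []. Qed.

(** The colour holds the truth values of the subformulas of [A] and one bit for membership in
    [W]. *)
Lemma finite_colouring A : exists (T : finType) (tp : F1 * F2 -> T),
  forall w w', tp w = tp w' -> (W w -> W w') /\ agree w w' A.
Proof.
have asb (P Q : Prop) : `[< P >] = `[< Q >] -> (P <-> Q).
  by move=> e; split=> h; apply/asboolP; [rewrite -e|rewrite e]; apply/asboolP.
suff [T [tp htp]] : exists (T : finType) (tp : F1 * F2 -> T),
    forall w w', tp w = tp w' -> agree w w' A.
  exists (T * bool)%type, (fun w => (tp w, `[< W w >])) => w w' [/htp ? e].
  by split=> // /(asb _ _ e).
elim: A => [i||B [T1 [t1 h1]] C [T2 [t2 h2]]|m B [T1 [t1 h1]]].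
- exists bool, (fun w => `[< rsat w (Var i) >]) => w w' e.
  by split=> //; apply: asb.
- by exists bool, (fun=> true).
- exists (T1 * T2 * bool)%type,
    (fun w => (t1 w, t2 w, `[< rsat w (Imp B C) >])) => w w' [/h1 ? /h2 ? e].
  by split=> //; apply: asb.
- exists (T1 * bool)%type,
    (fun w => (t1 w, `[< rsat w (Box m B) >])) => w w' [/h1 ? e].
  by split=> //; apply: asb.
Qed.

End RelativizedSatisfaction.

Lemma rsat_product (F1 F2 : frame unit) (V : nat -> set (F1 * F2)) w A :
  rsat setT V w A <-> @sat _ (product F1 F2) V w A.
Proof.
elim: A w => //= [A IHA B IHB|m A IHA] w; first by rewrite IHA IHB.
by split=> h w' => [Rww'|Rww' _]; apply/IHA/h.
Qed.

Lemma rsat_restriction (F1 F2 : frame unit) (W : set (F1 * F2))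
    (W0 : W !=set0) (V : nat -> set (F1 * F2)) (w : restriction W0) A :
  rsat W V (val w) A <-> sat (fun i => [set u : restriction W0 | V i (val u)]) w A.
Proof.
elim: A w => //= [A IHA B IHB|m A IHA] w; first by rewrite IHA IHB.
split=> h w'; first by move=> Rww'; apply/IHA/h => //; exact: set_mem (valP w').
move=> Rww' /mem_set Ww'.
exact: (iffRL (IHA (exist _ w' Ww')) (h (exist _ w' Ww') Rww')).
Qed.

(** Black boxes keep the horizontal coordinate, hence the level, and so are not counted. *)
Fixpoint hor_depth (A : formula modality) : nat :=
  match A with
  | Imp A1 A2 => maxn (hor_depth A1) (hor_depth A2)
  | Box hor A1 => (hor_depth A1).+1
  | Box ver A1 => hor_depth A1
  | _ => 0
  end.

(** * The finite model *)

Section FiniteModel.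
Variables (F1 F2 : frame unit) (W : set (F1 * F2)) (V : nat -> set (F1 * F2)).
Hypothesis F1_eucl : euclidean2 F1.
Hypothesis F2_S5 : frames_of logic_S5 F2.
Hypothesis W_closed : forall x x' y, W (x, y) -> taccess x x' -> W (x', y).
Variables (x0 : F1) (y0 : F2) (d : nat) (T : finType) (tp : F1 * F2 -> T).
Hypothesis tp_W : forall w w', tp w = tp w' -> W w -> W w'.

Local Notation L := (level x0).
Local Notation Y := (taccess y0).
Local Notation profileT := {ffun 'I_d.+1 * T -> bool}.

Definition profile (y : F2) : profileT :=
  [ffun p : 'I_d.+1 * T => `[< exists2 x, L p.1 x & tp (x, y) = p.2 >]].

Lemma profileP i y y' x : i <= d -> profile y = profile y' -> L i x ->
  exists2 x', L i x' & tp (x', y') = tp (x, y).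
Proof.
move=> id eyy' Lx; have lid : i < d.+1 by [].
have /ffunP/(_ (Ordinal lid, tp (x, y))) := eyy'; rewrite !ffunE /=.
by move=> e; apply/asboolP; rewrite -e; apply/asboolP; exists x.
Qed.

(* The copies of a profile are indexed by [bool * T]. To cover colour [t] while
   the value at a given copy [(b, _)] is prescribed, copy [(~~ b, t)] is used. *)
Definition vpoint : Type :=
  {p : profileT * bool * T | `[< exists2 y, Y y & profile y = p.1.1 >]}.

Definition vprofile (y' : vpoint) : profileT := (val y').1.1.

Definition vpoint_of y (Yy : Y y) (b : bool) (t : T) : vpoint :=
  exist _ (profile y, b, t) (asboolT (ex_intro2 _ _ y Yy erefl)).

Local Notation vfin := (Finite.clone vpoint _).
Local Notation row := {ffun vfin -> T}.

(** [s] places the vertical points on actual columns. White boxes rely on [real_profile], black ones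
    on [real_cover]. *)
Record realizes (i : nat) (f : row) (x : F1) (s : vpoint -> F2) : Prop := {
  real_level : L i x;
  real_Y : forall y', Y (s y');
  real_profile : forall y', profile (s y') = vprofile y';
  real_row : forall y', f y' = tp (x, s y');
  real_cover : forall y, Y y -> exists y', tp (x, s y') = tp (x, y)
}.

(** A copy other than [y'] with index [t] goes to a column of its profile where row [x] has colour
    [t], if there is one, and otherwise to any column of that profile. *)
Lemma realizes_at i x y y' : L i x -> Y y -> profile y = vprofile y' ->
  exists f s, realizes i f x s /\ s y' = y.
Proof.
move=> Lx Yy ey.
have /choice[s hs] y'' : exists z, [/\ Y z, profile z = vprofile y'',
    y'' = y' -> z = y &
    y'' <> y' ->
      (exists u, [/\ Y u, profile u = vprofile y'' & tp (x, u) = (val y'').2]) ->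
    tp (x, z) = (val y'').2].
  have [->|ne] := pselect (y'' = y'); first by exists y.
  have [[u [? ? ?]]|n] := pselect (exists u,
    [/\ Y u, profile u = vprofile y'' & tp (x, u) = (val y'').2]).
    by exists u.
  by have /asboolP[z Yz ez] := valP y''; exists z.
exists [ffun y'' => tp (x, s y'')], s; split; last by have [_ _ ->] := hs y'.
split=> //; try by move=> y''; have [] := hs y''.
  by move=> y''; rewrite ffunE.
move=> z Yz; exists (vpoint_of Yz (~~ (val y').1.2) (tp (x, z))).
set y'' := vpoint_of _ _ _; have [_ _ _ ->] := hs y'' => //.
  by move=> /(congr1 (fun u : vpoint => (val u).1.2)) /=; case: (_.1.2).
by exists z.
Qed.

(** Only level and row are stored, not [x] and [s], so this is a subtype of a finite type. *)
Definition hpoint : Type :=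
  {p : 'I_d.+1 * row | `[< exists x s, realizes p.1 p.2 x s >]}.

Definition hlevel (p : hpoint) : nat := (val p).1.
Definition hrow (p : hpoint) : row := (val p).2.
Definition hrealizes (p : hpoint) := realizes (hlevel p) (hrow p).

Lemma hpoint_realized (p : hpoint) : exists x s, hrealizes p x s.
Proof. exact/asboolP/(valP p). Qed.

Lemma hlevel_le (p : hpoint) : hlevel p <= d.
Proof. by rewrite -ltnS; exact: ltn_ord. Qed.

Lemma hpoint_at i x y y' : i <= d -> L i x -> Y y -> profile y = vprofile y' ->
  exists p s, [/\ hlevel p = i, hrealizes p x s & s y' = y].
Proof.
rewrite -ltnS => lid Lx Yy /(realizes_at Lx Yy)[f [s [rs sy]]].
have P : `[< exists x s, realizes (Ordinal lid) f x s >].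
  by apply/asboolP; exists x, s.
by exists (exist _ (Ordinal lid, f) P), s.
Qed.

Lemma Yy0 : Y y0.
Proof. by have /frames_of_S5[] := F2_S5. Qed.

Lemma Y_acc y y' : Y y -> taccess y y' <-> Y y'.
Proof.
have /frames_of_S5[_ tr sy] := F2_S5.
move=> Yy; split=> h; first exact: tr Yy h.
exact: tr (sy _ _ Yy) h.
Qed.

Let root_v (b : bool) (t : T) := vpoint_of Yy0 b t.

(** Supplies the point of refutation; among the copies of the profile of [y0] the choice is
    arbitrary. *)
Lemma hpoint0 : exists p s, [/\ hlevel p = 0, hrealizes p x0 s &
  s (root_v true (tp (x0, y0))) = y0].
Proof. exact: hpoint_at Yy0 _. Qed.

Lemma hfin_nonempty : [set: hpoint] !=set0.
Proof. by have [p _] := hpoint0; exists p. Qed.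

Lemma vfin_nonempty : [set: vpoint] !=set0.
Proof. by exists (root_v true (tp (x0, y0))). Qed.

(** Points of level [d] see nothing; [truth] never looks beyond this level. *)
Definition hframe : frame unit :=
  Frame (fun (_ : unit) p => [set q : hpoint | hlevel q = (hlevel p).+1])
    hfin_nonempty.

Definition vframe : frame unit :=
  Frame (fun (_ : unit) _ => [set: vpoint]) vfin_nonempty.

Lemma hframe_finite : finite_frame hframe.
Proof. exact: (@finite_finset (Finite.clone hpoint _)). Qed.

Lemma vframe_finite : finite_frame vframe.
Proof. exact: (@finite_finset vfin). Qed.

Lemma hframe_eucl : euclidean2 hframe.
Proof. by move=> x y u z; rewrite /taccess /= => -> ->. Qed.

Lemma vframe_S5 : frames_of logic_S5 vframe.
Proof. exact/frames_of_S5. Qed.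

Lemma hframe_box_iter_Bot n :
  valid F1 (box_iter n Bot) -> valid hframe (box_iter n Bot).
Proof.
move=> /valid_box_iter_Bot hn; apply/valid_box_iter_Bot => p q pq.
have {pq} eq : hlevel q = hlevel p + n.
  elim: n q pq {hn} => [|n IHn] q; first by move=> ->; rewrite addn0.
  by case=> r /IHn er; rewrite /taccess /= => ->; rewrite er addnS.
(* The row of [q] comes from a point of [F1] at level [hlevel p + n], and the last [n] edges leading
   to it contradict [hn]. *)
have [x [s rs]] := hpoint_realized q; move: (real_level rs); rewrite eq.
by case/level_add => z _; apply: hn.
Qed.

(** [setT] yields the domain and [V i] the valuation. By [realizes_tp] the choice of [x] and [s]
    does not affect the colour. *)
Definition fin_pts (E : set (F1 * F2)) : set (hframe * vframe) :=
  [set w | exists x s, [/\ hrealizes w.1 x s, W (x, s w.2) & E (x, s w.2)]].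

Local Notation W' := (fin_pts setT).
Local Notation V' := (fun i => fin_pts (V i)).

Lemma realizes_tp (p : hpoint) x s x' s' y' :
  hrealizes p x s -> hrealizes p x' s' -> tp (x, s y') = tp (x', s' y').
Proof. by move=> r r'; rewrite -(real_row r) -(real_row r'). Qed.

Lemma fin_ptsP (p : hpoint) x s y' : hrealizes p x s ->
  W' (p, y') <-> W (x, s y').
Proof.
move=> r; split=> [[x' [s' [r' /= w _]]]|w]; last by exists x, s.
exact: tp_W (realizes_tp y' r' r) w.
Qed.

Lemma fin_ptsT : W = setT -> W' = setT.
Proof.
move=> WT; apply/seteqP; split=> // -[p y'] _.
by have [x [s r]] := hpoint_realized p; exists x, s; rewrite WT.
Qed.

(** The columns [s y'] and [s' y'] share a profile, so the colour of [(x', s' y')] recurs over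
    [s y'] within the level of [q], all of which [x] sees. *)
Lemma realizes_succ (p q : hpoint) x s x' s' y' :
  hlevel q = (hlevel p).+1 -> hrealizes p x s -> hrealizes q x' s' ->
  exists2 z, taccess x z & tp (z, s y') = tp (x', s' y').
Proof.
move=> eq r r'.
have [||z Lz e] := @profileP (hlevel q) (s' y') (s y') x' (hlevel_le q).
- by rewrite (real_profile r) (real_profile r').
- exact: real_level r'.
exists z => //; rewrite -(level_succ F1_eucl (real_level r)) -eq.
exact: Lz.
Qed.

Lemma fin_pts_closed (p q : hframe) y' :
  W' (p, y') -> taccess p q -> W' (q, y').
Proof.
move=> [x [s [r w _]]] pq; have [x' [s' r']] := hpoint_realized q.
apply/(fin_ptsP _ r'); have [z xz e] := realizes_succ y' pq r r'.
exact: tp_W e (W_closed w xz).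
Qed.

(** The inequality leaves enough levels after that of [p] for the nested white boxes of [B]. *)
Lemma truth B (p : hpoint) x s y' :
  (forall w w', tp w = tp w' -> agree W V w w' B) ->
  hlevel p + hor_depth B <= d -> hrealizes p x s -> W (x, s y') ->
  rsat W' V' (p, y') B <-> rsat W V (x, s y') B.
Proof.
elim: B p x s y' => //= [i|B IHB C IHC|[] B IHB] p x s y' hB hd r w.
- split=> [[x' [s' [r' /= _]]]|v]; last by exists x, s.
  by have [] := hB _ _ (realizes_tp y' r' r) => /= -[].
- rewrite addn_maxr geq_max in hd; case/andP: hd => hd1 hd2.
  rewrite (IHB _ _ _ y' _ hd1 r w); last by move=> ? ? /hB[_ []].
  by rewrite (IHC _ _ _ y' _ hd2 r w) // => ? ? /hB[_ []].
- have hlt : (hlevel p).+1 <= d by apply: leq_trans hd; rewrite addnS ltnS leq_addr.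
  have hB' u u' : tp u = tp u' -> agree W V u u' B by move=> /hB[].
  split=> [h [x' _] /= [xx' ->] w'|h [q _] /= [pq ->] w'].
    (* The prescribed value is used here: [x'] is realized with [y'] still sent to the column
       [s y']. *)
    have [||//|q [s' [eq r' es']]] := @hpoint_at _ x' (s y') y' hlt.
    + by rewrite (level_succ F1_eucl (real_level r)).
    + exact: real_Y r _.
    + exact: real_profile r _.
    rewrite -es' in w' *; apply/(IHB _ _ _ _ hB' _ r') => //.
      by rewrite eq addSnnS.
    by apply: h => //=; apply/(fin_ptsP _ r').
  have [x' [s' r']] := hpoint_realized q.
  have [z xz e] := realizes_succ y' pq r r'.
  have w'' := iffLR (fin_ptsP _ r') w'.
  apply/(IHB _ _ _ _ hB' _ r') => //; first by rewrite pq addSnnS.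
  apply/(agree_rsat (hB' _ _ e))/h => //=.
  exact: tp_W (esym e) w''.
- have hB' u u' : tp u = tp u' -> agree W V u u' B by move=> /hB[].
  split=> [h [_ y] /= [-> yy] w'|h [_ y''] /= [-> _] w'].
    (* Column [y] need not be in the range of [s], but its colour in row [x] is. *)
    have [|y'' e] := real_cover r (y := y); first exact/(Y_acc _ (real_Y r y')).
    have w'' := tp_W (esym e) w'.
    apply/(agree_rsat (hB' _ _ e))/(IHB _ _ _ _ hB' _ r) => //.
    by apply: h => //; apply/(fin_ptsP _ r).
  have w'' := iffLR (fin_ptsP _ r) w'.
  apply/(IHB _ _ _ _ hB' _ r) => //; apply: h => //=; split=> //.
  exact/(Y_acc _ (real_Y r y'))/(real_Y r).
Qed.

End FiniteModel.

(** Serves both claims: the clause on [W = setT] yields full products, and the transfer of every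
    [box_iter n Bot] covers both forms of [Lambda]. *)
Lemma finite_refutation (F1 F2 : frame unit) (W : set (F1 * F2))
    (V : nat -> set (F1 * F2)) (w : F1 * F2) A :
  valid F1 Ath -> frames_of logic_S5 F2 ->
  (forall x x' y, W (x, y) -> taccess x x' -> W (x', y)) ->
  W w -> ~ rsat W V w A ->
  exists (G1 G2 : frame unit) (W' : set (G1 * G2)) (V' : nat -> set (G1 * G2))
    (w' : G1 * G2),
  [/\ finite_frame G1 /\ finite_frame G2,
      [/\ valid G1 Ath, frames_of logic_S5 G2 &
        forall n, valid F1 (box_iter n Bot) -> valid G1 (box_iter n Bot)],
      (forall x x' y, W' (x, y) -> taccess x x' -> W' (x', y)),
      (W = setT -> W' = setT) & W' w' /\ ~ rsat W' V' w' A].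
Proof.
case: w => x0 y0 /valid_Ath e1 e2 cl Ww nA.
have [T [tp htp]] := finite_colouring W V A.
have tp_W w w' : tp w = tp w' -> W w -> W w' by move=> /htp[].
have [p [s [p0 r ey]]] := @hpoint0 _ _ e2 x0 y0 (hor_depth A) _ tp.
set y' := vpoint_of _ _ _ _ _ _ in ey.
exists (hframe e2 x0 y0 (hor_depth A) tp), (vframe e2 x0 y0 (hor_depth A) tp).
exists (fin_pts W setT), (fun i => fin_pts W (V i)), (p, y').
split; [split| split| | | split].
- exact: hframe_finite.
- exact: vframe_finite.
- exact/valid_Ath/hframe_eucl.
- exact: vframe_S5.
- exact: hframe_box_iter_Bot.
- exact: fin_pts_closed.
- exact: fin_ptsT.
- by apply/(fin_ptsP _ _ r); rewrite ?ey.
- rewrite (truth e1 e2 tp_W _ _ r) ?ey ?p0 //.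
  by move=> ? ? /htp[].
Qed.

(** * From finite refutations to the finite model properties *)

Lemma is_semiproduct_restriction (F1 F2 : frame unit) (W : set (F1 * F2))
    (W0 : W !=set0) :
  (forall x x' y, W (x, y) -> taccess x x' -> W (x', y)) ->
  is_semiproduct F1 F2 (restriction W0).
Proof.
move=> cl; exists W, W0; split=> // -[x' y'] [[x y] w] /= [/= xx' ->].
exact: cl w xx'.
Qed.

Lemma product_finite (F1 F2 : frame unit) :
  finite_frame F1 -> finite_frame F2 -> finite_frame (product F1 F2).
Proof. by move=> f1 f2; rewrite /finite_frame -setXTT; apply: finite_setX. Qed.

Lemma restriction_finite (F1 F2 : frame unit) (W : set (F1 * F2))
    (W0 : W !=set0) :
  finite_frame F1 -> finite_frame F2 -> finite_frame (restriction W0).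
Proof.
move=> f1 f2; rewrite /finite_frame -(preimage_setT val).
apply: finite_preimage (product_finite f1 f2).
by move=> ? ? _ _; apply: val_inj.
Qed.

Theorem theorem6p1 (Lambda : set (formula unit))
  (hLambda : Lambda = logic_add (@logic_K unit) Ath \/
    exists2 n : nat, (1 <= n)%N &
      Lambda = logic_add (logic_add (@logic_K unit) (box_iter n Bot)) Ath) :
  product_fmp Lambda logic_S5 /\ semiproduct_fmp Lambda logic_S5.
Proof.
have framesA F : frames_of Lambda F -> valid F Ath.
  by case: hLambda => [->|[n _ ->]] /frames_of_add[].
have framesI (F G : frame unit) : frames_of Lambda F -> valid G Ath ->
    (forall n, valid F (box_iter n Bot) -> valid G (box_iter n Bot)) ->
    frames_of Lambda G.
  case: hLambda => [->|[n _ ->]] hF hG FG; apply/frames_of_add; split=> //.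
    exact: frames_of_K.
  apply/frames_of_add; split; first exact: frames_of_K.
  by apply: FG; move/frames_of_add: hF => -[/frames_of_add[]].
(* Finite frames form a subclass, so one inclusion is immediate. *)
split; apply/seteqP; split=> A hA F; try by case=> hF _; apply: hA.
- move=> [F1 [F2 [h1 h2 ->]]] V w; apply: contrapT => /rsat_product nA.
  have [G1 [G2 [W' [V' [w' [[f1 f2] [a1 g2 b1] _ WT [_ nA']]]]]]] :=
    finite_refutation (framesA _ h1) h2 (fun _ _ _ _ _ => I) I nA.
  apply: nA'; rewrite WT //; apply/rsat_product/hA; split.
    by exists G1, G2; split=> //; apply: framesI a1 b1.
  exact: product_finite.
- move=> [F1 [F2 [h1 h2 [W [W0 [cl ->]]]]]] V w; apply: contrapT => nA.
  (* [V] lives on the subtype, so it is extended to all pairs by falsity outside [W]. *)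
  pose V1 i := [set u | exists Wu : u \in W, V i (exist _ u Wu)].
  have E : (fun i => [set u : restriction W0 | V1 i (val u)]) = V.
    apply/funext => i; apply/seteqP; split=> -[u Wu] /=; last by exists Wu.
    by case=> Wu'; rewrite (bool_irrelevance Wu Wu').
  have cl' x x' y : W (x, y) -> taccess x x' -> W (x', y).
    by move=> Wxy xx'; apply: cl; exists (x, y).
  rewrite -E -rsat_restriction in nA.
  have [G1 [G2 [W' [V' [w' [[f1 f2] [a1 g2 b1] cl2 _ [Ww' nA']]]]]]] :=
    finite_refutation (framesA _ h1) h2 cl' (set_mem (valP w)) nA.
  have W0' : W' !=set0 by exists w'.
  apply: nA'; pose u : restriction W0' := exist _ w' (mem_set Ww').
  apply/(@rsat_restriction _ _ _ W0' _ u)/hA; split.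
    exists G1, G2; split=> //; first exact: framesI a1 b1.
    exact: is_semiproduct_restriction.
  exact: restriction_finite.
Qed.
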